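(* Let $T$ be a measure preserving transformation on a separable probability space $(X,\mathcal{B},\mu)$. If $T$ is sweeping out on a dense collection, then $T$ is lightly mixing on a dense algebra.
   Context: A transformation on $(X,\mathcal{B},\mu)$ is an invertible measurable map $T:X\to X$ with measurable inverse; it is measure preserving if $\mu(T^{-1}A)=\mu(A)$ for all $A\in\mathcal{B}$. The space is separable in the sense that $\mathcal{B}$ (modulo null sets) is a separable metric space under the distance $d(A,B)=\mu(A\triangle B)$; dense means dense for $d$. $T$ is sweeping out on a collection $\mathcal{D}\subset\mathcal{B}$ if $\liminf_{n\to\infty}\mu(T^nA\cap B)>0$ for each $A\in\mathcal{D}$ and each $B\in\mathcal{B}$, both of positive measure (equivalently, for each $A\in\mathcal{D}$ of positive measure and each infinite sequence $k_1,k_2,\ldots$ of distinct positive integers, $\mu(\bigcup_{i=1}^{\infty}T^{k_i}A)=1$). $T$ is sweeping out on a dense collection if it is sweeping out on some dense subset $\mathcal{D}\subset\mathcal{B}$. $T$ is lightly mixing on a dense algebra if there is an algebra of sets $\mathcal{G}\subset\mathcal{B}$, dense in $\mathcal{B}$, such that $\liminf_{n\to\infty}\mu(T^nA\cap B)>0$ for all $A,B\in\mathcal{G}$ having positive measure. *)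

(* Defs.v *)
From HB Require Import structures.
From mathcomp Require Import all_boot all_order all_algebra.
From mathcomp Require Import all_classical all_reals all_analysis.

Set Implicit Arguments.
Unset Strict Implicit.
Unset Printing Implicit Defensive.

Import Order.TTheory GRing.Theory Num.Theory.
Import numFieldNormedType.Exports.

Local Open Scope classical_set_scope.
Local Open Scope ring_scope.
Local Open Scope ereal_scope.

Definition transformation d (X : measurableType d) (T : X -> X) : Prop :=
  measurable_fun [set: X] T /\
  exists S : X -> X,
    [/\ cancel T S, cancel S T & measurable_fun [set: X] S].

Definition measure_preserving d (X : measurableType d) (R : realType)
    (mu : probability X R) (T : X -> X) : Prop :=
  forall A : set X, measurable A -> mu (T @^-1` A) = mu A.

Definition symdiff_dist d (X : measurableType d) (R : realType)
    (mu : probability X R) (A B : set X) : \bar R := mu (A `+` B).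

Definition dense_collection d (X : measurableType d) (R : realType)
    (mu : probability X R) (D : set (set X)) : Prop :=
  D `<=` measurable /\
  forall B : set X, measurable B -> forall e : R, (0 < e)%R ->
    exists2 A : set X, D A & symdiff_dist mu A B < e%:E.

(* The symmetric-difference distance is a pseudometric on measurable sets; a
   countable dense family of classes modulo null sets is the same thing as a
   countable dense family of representatives. *)
Definition separable_probability d (X : measurableType d) (R : realType)
    (mu : probability X R) : Prop :=
  exists2 C : set (set X), countable C & dense_collection mu C.

Definition set_algebra (X : Type) (G : set (set X)) : Prop :=
  [/\ G setT, setC_closed G & setU_closed G].

Definition sweeping_out_on d (X : measurableType d) (R : realType)
    (mu : probability X R) (T : X -> X) (D : set (set X)) : Prop :=
  forall A B : set X, D A -> measurable B -> 0 < mu A -> 0 < mu B ->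
    0 < limn_einf (fun n : nat => mu ((iter n T @` A) `&` B)).

Definition sweeping_out_on_dense_collection d (X : measurableType d)
    (R : realType) (mu : probability X R) (T : X -> X) : Prop :=
  exists D : set (set X), dense_collection mu D /\ sweeping_out_on mu T D.

Definition lightly_mixing_on_dense_algebra d (X : measurableType d)
    (R : realType) (mu : probability X R) (T : X -> X) : Prop :=
  exists G : set (set X),
    [/\ set_algebra G,
        dense_collection mu G &
        forall A B : set X, G A -> G B -> 0 < mu A -> 0 < mu B ->
          0 < limn_einf (fun n : nat => mu ((iter n T @` A) `&` B))].

(* Main.v *)
Require Import Defs.
From mathcomp Require Import all_boot all_order all_algebra.
From mathcomp Require Import all_classical all_reals all_analysis.
From mathcomp Require Import lra.

(** Write [D] for the dense collection of sets on which [T] sweeps out.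

If there are no measurable sets of small positive measure, then density forces
every measurable set to agree up to a null set with a member of [D], and the
algebra of all measurable sets works ([no_small_sets_case]).

Otherwise [D] contains sets of arbitrarily small positive measure.  Sweeping
out does not pass to subsets, so disjoint sweeping sets cannot simply be cut
out.  Instead, take [A 0], [A 1], ... in [D] whose measures decrease so fast
that the union of all later sets is negligible in comparison with the lower
bounds already secured ([tower_exists]).  The cores
[C n = A n minus the union of the later A k] are then pairwise disjoint, and
[C j] mixes with [C i] whenever [i <= j] ([core_mixes]).  To see this, remove
from [A i] only [A (i+1)], ..., [A j]; since [A j] sweeps, its images
eventually meet this set of positive measure in at least some fixed amount.
Only after that are the later sets chosen, so small that passing from these
two sets to the cores costs less than that amount.  For [i > j] the
argument breaks down: [A i] is itself removed from [A j], and the images of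
[A j] overlap [A i] in no more than the measure of [A i].

This asymmetry is harmless because cores can be placed infinitely often.  Take a dense
sequence [B p], each term repeated infinitely often, and alter [B p] only on
the cores [C j] with [j >= p], each of which is either absorbed or expelled
according to the [p]-th bit of a code of [j].  The change is at most
the tail of the tower, so the altered sets are still dense.  Every finite
pattern of bits occurs for infinitely many [j], hence every nonempty member of
the algebra of the altered sets contains cores of arbitrarily large index
([recoded_algebra_core]).  Given members [E] and [F], pick a core [C i] in [F]
and then a core [C j] in [E] with [j >= i]: these two already mix
([small_sets_case]). *)

Set Implicit Arguments.
Unset Strict Implicit.
Unset Printing Implicit Defensive.

Import Order.TTheory GRing.Theory Num.Theory.
Import numFieldNormedType.Exports.

Local Open Scope classical_set_scope.
Local Open Scope ring_scope.

(** * Positive inferior limits and cofinal codes *)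

Lemma limn_einf_gt0P (R : realType) (u : (\bar R)^nat) :
  (0 < limn_einf u)%E <->
  exists2 e : R, 0 < e & exists N, forall n, (N <= n)%N -> (e%:E <= u n)%E.
Proof.
rewrite limn_einf_lim (cvg_lim _ (ereal_nondecreasing_cvgn (@nondecreasing_einfs _ u)))//.
split=> [/ereal_sup_gt[_ [N _ <-]] u_gt0|[e e0 [N Nu]]].
  have [e e0 eu] : exists2 e : R, 0 < e & (e%:E <= einfs u N)%E.
    move: u_gt0; case: (einfs u N) => [r|_|//]; last by exists 1; rewrite ?leey.
    by rewrite lte_fin => r0; exists r.
  exists e => //; exists N => n Nn; apply: le_trans eu _.
  by apply: ereal_inf_lbound; exists n.
apply: (@lt_le_trans _ _ e%:E); first by rewrite lte_fin.
apply: le_trans (ereal_sup_ubound (_ : range (einfs u) (einfs u N))); last by exists N.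
by apply: le_ereal_inf_tmp => _ [n /= Nn <-]; exact: Nu.
Qed.

Lemma injective_unbounded (g : nat -> nat) : injective g ->
  forall N, exists q, (N <= g q)%N.
Proof.
move=> g_inj N; apply: contrapT => /forallNP bdd.
have ltN q : (g q < N)%N by rewrite ltnNge; apply/negP.
pose h (q : 'I_N.+1) := Ordinal (ltN q).
have /leq_card : injective h by move=> x y [] /g_inj/val_inj.
by rewrite !card_ord ltnn.
Qed.

(** A code stands for a word of bits paired with a counter; the counter makes
    each word have infinitely many codes. *)
Definition code_bit (j p : nat) : bool :=
  nth false (odflt ([::], 0%N) (unpickle j : option (seq bool * nat))).1 p.

Lemma code_bit_pattern (b : nat -> bool) (n N : nat) :
  exists2 j, (N <= j)%N & forall p, (p < n)%N -> code_bit j p = b p.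
Proof.
have [|q Nq] := @injective_unbounded (fun q => pickle (mkseq b n, q)) _ N.
  by move=> x y /(pcan_inj pickleK) [].
by exists (pickle (mkseq b n, q)) => // p pn; rewrite /code_bit pickleK /= nth_mkseq.
Qed.

(** A sequence of indices in which every natural number recurs forever. *)
Definition repeat_index (p : nat) : nat :=
  (odflt (0%N, 0%N) (unpickle p : option (nat * nat))).1.

Lemma repeat_index_cofinal (m N : nat) :
  exists2 p, (N <= p)%N & repeat_index p = m.
Proof.
have [|q Nq] := @injective_unbounded (fun q => pickle (m, q)) _ N.
  by move=> x y /(pcan_inj pickleK) [].
by exists (pickle (m, q)) => //; rewrite /repeat_index pickleK.
Qed.

(** * Real-valued probabilities *)

Section probability_reals.
Context {d : measure_display} {X : measurableType d} {R : realType}.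
Context (mu : probability X R).

Local Notation m A := (fine (mu A)).

Lemma fine_probE (A : set X) : measurable A -> mu A = (m A)%:E.
Proof. by move=> mA; rewrite fineK// fin_num_measure. Qed.

Lemma fine_prob_ge0 (A : set X) : 0 <= m A.
Proof. exact/fine_ge0/measure_ge0. Qed.

Lemma fine_prob_le (A B : set X) : measurable A -> measurable B -> A `<=` B -> m A <= m B.
Proof.
move=> mA mB AB; rewrite -lee_fin -!fine_probE//.
by apply: le_measure => //; rewrite inE.
Qed.

Lemma fine_probU_le (A B : set X) : measurable A -> measurable B -> m (A `|` B) <= m A + m B.
Proof.
move=> mA mB; rewrite -lee_fin EFinD -!fine_probE//; last exact: measurableU.
exact: measureU2.
Qed.

Lemma fine_probD_ge (A B : set X) : measurable A -> measurable B ->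
  m A - m B <= m (A `\` B).
Proof.
move=> mA mB; rewrite lerBlDr; apply: le_trans (fine_probU_le (measurableD mA mB) mB).
apply: fine_prob_le => //; first by apply: measurableU => //; exact: measurableD.
by move=> x Ax; have [Bx|nBx] := pselect (B x); [right|left].
Qed.

Lemma fine_prob_bigcup_le (A : nat -> set X) (r : R) : (forall k, measurable (A k)) ->
  (forall n, \sum_(0 <= k < n) m (A k) <= r) -> m (\bigcup_k A k) <= r.
Proof.
move=> mA Ar; have mU : measurable (\bigcup_k A k) by exact: bigcup_measurable.
rewrite -lee_fin -fine_probE//; apply: le_trans (generalized_Boole_inequality mu mA mU) _.
apply: lime_le; first exact: is_cvg_nneseries.
apply: nearW => n; rewrite (eq_bigr (fun k => (m (A k))%:E)); last by move=> k _; exact: fine_probE.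
by rewrite sumEFin lee_fin.
Qed.

(** * Residues and tails of a sequence of sets *)

Definition tail_union (A : nat -> set X) (n : nat) : set X :=
  \bigcup_(k in [set k | (n <= k)%N]) A k.

(** The part of [A i] that survives the removal of the later sets with index
    below [n]; unlike the final core, it is known at stage [n] of an inductive
    choice of [A]. *)
Definition residue (A : nat -> set X) (i n : nat) : set X :=
  A i `\` \bigcup_(k in [set k | (i < k < n)%N]) A k.

Lemma residue_last A n : residue A n n.+1 = A n.
Proof.
rewrite /residue bigcup0 ?setD0// => k /= /andP[nk]; by rewrite ltnS leqNgt nk.
Qed.

Lemma residueS A i n : (i < n)%N -> residue A i n.+1 = residue A i n `\` A n.
Proof.
move=> i_n; rewrite /residue setDDl; congr (_ `\` _); apply/seteqP; split=> x.
  move=> [k /= /andP[ik]]; rewrite ltnS leq_eqVlt => /orP[/eqP->|kn] Akx; first by right.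
  by left; exists k => //=; rewrite ik.
case=> [[k /= /andP[ik kn] Akx]|Anx].
  by exists k => //=; rewrite ik ltnS ltnW.
by exists n => //=; rewrite i_n /=.
Qed.

Lemma eq_residue A A' i n : (forall k, (k < n)%N -> A k = A' k) -> (i < n)%N ->
  residue A i n = residue A' i n.
Proof.
move=> AA' i_n; rewrite /residue AA'//; congr (_ `\` _).
by apply: eq_bigcupr => k /= /andP[_ kn]; exact: AA'.
Qed.

Lemma measurable_tail_union A n : (forall k, measurable (A k)) -> measurable (tail_union A n).
Proof. by move=> mA; exact: bigcup_measurable. Qed.

Lemma measurable_residue A i n : (forall k, measurable (A k)) ->
  measurable (residue A i n).
Proof. by move=> mA; apply: measurableD => //; exact: bigcup_measurable. Qed.

(** Read [e n] as the measure still available after [A 0], ..., [A n.-1] are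
    chosen: spending at most half of it at each step never exhausts it. *)
Lemma fine_prob_tail_le (A : nat -> set X) (e : nat -> R) :
  (forall k, measurable (A k)) -> (forall n, 0 < e n) ->
  (forall n, m (A n) <= e n / 2) -> (forall n, e n.+1 <= e n / 2) ->
  forall n, m (tail_union A n) <= e n.
Proof.
move=> mA e0 Ae ee n.
have -> : tail_union A n = \bigcup_k A (n + k)%N.
  apply/seteqP; split=> x [k /= nk Akx]; last by exists (n + k)%N => //=; rewrite leq_addr.
  by exists (k - n)%N => //; rewrite subnKC.
apply: fine_prob_bigcup_le => // N.
apply: (@le_trans _ _ (e n - e (n + N)%N)); last by have := e0 (n + N)%N; lra.
elim: N => [|N ih]; first by rewrite big_nil addn0 subrr.
rewrite big_nat_recr//= addnS.
have := Ae (n + N)%N; have := ee (n + N)%N; have := ih; lra.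
Qed.

(** * Quantitative mixing *)

Context (T : X -> X).
Context (T_transformation : transformation T).
Context (T_preserving : measure_preserving mu T).

(** Images under [T] are preimages under its inverse, so they are measurable,
    and invariance of the measure under preimages carries over to them. *)
Lemma image_iter_measurable n (A : set X) : measurable A ->
  measurable (iter n T @` A) /\ mu (iter n T @` A) = mu A.
Proof.
have [mT [S [TS ST mS]]] := T_transformation.
move=> mA; elim: n => [|n [mn eqn]]; first by rewrite /= image_id.
have -> : iter n.+1 T @` A = S @^-1` (iter n T @` A).
  apply/seteqP; split=> [_ [x Ax <-]|x [y Ay yx]]; first by exists x => //=; rewrite TS.
  by exists y => //=; rewrite yx ST.
have mSn : measurable (S @^-1` (iter n T @` A)).
  by rewrite -[X in measurable X]setTI; exact: mS.
split=> //; rewrite -T_preserving// -eqn; congr (mu _).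
by apply/seteqP; split=> x; rewrite /= TS.
Qed.

Definition mixes (e : R) (A B : set X) : Prop :=
  exists N, forall n, (N <= n)%N -> e <= m (iter n T @` A `&` B).

Lemma measurable_imageI n A B : measurable A -> measurable B ->
  measurable (iter n T @` A `&` B).
Proof. by move=> mA mB; apply: measurableI => //; case: (image_iter_measurable n mA). Qed.

Lemma mixesP A B : measurable A -> measurable B ->
  (0 < limn_einf (fun n => mu (iter n T @` A `&` B)))%E <->
  exists2 e : R, 0 < e & mixes e A B.
Proof.
move=> mA mB; rewrite limn_einf_gt0P.
by split=> -[e e0 [N NAB]]; exists e => //; exists N => n /NAB;
  rewrite fine_probE ?lee_fin//; exact: measurable_imageI.
Qed.

Lemma mixes_le e A B : measurable A -> measurable B -> mixes e A B -> e <= m B.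
Proof.
move=> mA mB [N /(_ N (leqnn N))] /le_trans; apply.
by apply: fine_prob_le => //; exact: measurable_imageI.
Qed.

(** The images of [A] and of [A'] differ by the image of the difference, whose
    measure is that of the difference by invariance; this is why the loss
    does not depend on the number of iterations. *)
Lemma mixes_perturb e r s A A' B B' :
  measurable A -> measurable A' -> measurable B -> measurable B' ->
  m (A `\` A') <= r -> m (B `\` B') <= s ->
  mixes e A B -> mixes (e - r - s) A' B'.
Proof.
move=> mA mA' mB mB' Ar Bs [N NAB]; exists N => n /NAB eAB.
have mAA' : measurable (A `\` A') by exact: measurableD.
have mBB' : measurable (B `\` B') by exact: measurableD.
have [mI eqI] := image_iter_measurable n mAA'.
have mAB' := measurable_imageI n mA' mB'.
have : m (iter n T @` A `&` B) <=
    m ((iter n T @` A' `&` B') `|` (iter n T @` (A `\` A') `|` (B `\` B'))).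
  apply: fine_prob_le; [exact: measurable_imageI|by do 2 apply: measurableU => //|].
  move=> _ [[x Ax <-] Bx].
  have [A'x|nA'x] := pselect (A' x); last by right; left; exists x.
  have [B'x|nB'x] := pselect (B' (iter n T x)); last by right; right.
  by left; split=> //; exists x.
have := fine_probU_le mAB' (measurableU _ _ mI mBB'); have := fine_probU_le mI mBB'; rewrite eqI.
by move: eAB Ar Bs; lra.
Qed.

Lemma mixes_weaken e e' A B : e' <= e -> mixes e A B -> mixes e' A B.
Proof. by move=> le [N NAB]; exists N => n /NAB; exact: le_trans. Qed.

Lemma mixes_subset e A A' B B' :
  measurable A -> measurable A' -> measurable B -> measurable B' ->
  A `<=` A' -> B `<=` B' -> mixes e A B -> mixes e A' B'.
Proof.
rewrite -setD_eq0 -setD_eq0 => mA mA' mB mB' AA' BB' eAB.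
have -> : e = e - 0 - 0 by rewrite !subr0.
by apply: mixes_perturb eAB => //; rewrite ?AA' ?BB' measure0.
Qed.

Lemma mixes_uniform (A : set X) (B : nat -> set X) n :
  (forall i, (i < n)%N -> exists2 e : R, 0 < e & mixes e A (B i)) ->
  exists2 e, 0 < e & forall i, (i < n)%N -> mixes e A (B i).
Proof.
elim: n => [|n ih] AB; first by exists 1.
have [|e e0 eAB] := ih; first by move=> i i_n; apply: AB; exact: ltnW.
have [e' e'0 e'AB] := AB n (leqnn _).
exists (Num.min e e'); first by rewrite lt_min e0.
move=> i; rewrite ltnS leq_eqVlt => /orP[/eqP->|/eAB].
  by apply: mixes_weaken e'AB; rewrite ge_min lexx orbT.
by apply: mixes_weaken; rewrite ge_min lexx.
Qed.

(** * Construction of the tower *)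

(** The factor 3 leaves room for two losses of size [e'], one in each of the
    two sets, when both are shrunk to their cores later on. *)
Definition tower_step (D : set (set X)) (n : nat) (A : nat -> set X) (e e' : R) : Prop :=
  [/\ D (A n), 0 < e', e' <= e / 2, m (A n) <= e / 2 &
      forall i, (i <= n)%N -> mixes (3 * e') (A n) (residue A i n.+1)].

(** The invariant [e < m (residue A i n)] keeps all residues non-null once a
    set of measure at most [e / 2] has been removed, so that a sweeping set
    [a] chosen next mixes with each of these finitely many residues; the new
    budget is a third of a rate common to all of them, capped at [e / 2]. *)
Lemma tower_extend (D : set (set X)) (n : nat) (A : nat -> set X) (e : R) :
  D `<=` measurable ->
  (forall a B, D a -> measurable B -> 0 < m a -> 0 < m B ->
    exists2 e : R, 0 < e & mixes e a B) ->
  (forall r : R, 0 < r -> exists2 a, D a & 0 < m a <= r) ->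
  0 < e -> (forall k, measurable (A k)) ->
  (forall i, (i < n)%N -> e < m (residue A i n)) ->
  exists A' e', [/\ forall k, measurable (A' k),
    forall k, (k < n)%N -> A' k = A k & tower_step D n A' e e'].
Proof.
move=> mD sweep small e0 mA eA.
have [a Da /andP[a0 ae]] : exists2 a, D a & 0 < m a <= e / 2 by apply: small; lra.
pose A' k := if k == n then a else A k.
have A'n : A' n = a by rewrite /A' eqxx.
have A'A k : (k < n)%N -> A' k = A k by move=> kn; rewrite /A' ltn_eqF.
have mA' k : measurable (A' k) by rewrite /A'; case: eqP => // _; exact: mD.
have res0 i : (i < n.+1)%N -> 0 < m (residue A' i n.+1).
  rewrite ltnS leq_eqVlt => /orP[/eqP->|i_n]; first by rewrite residue_last A'n.
  have mres := measurable_residue i n mA'.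
  rewrite residueS//; have := fine_probD_ge mres (mA' n).
  rewrite A'n (eq_residue A'A i_n); have := eA i i_n; lra.
(* The index [n] is included: [a] must also mix with itself. *)
have [|r r0 rA'] := @mixes_uniform a (fun i => residue A' i n.+1) n.+1.
  by move=> i i_n; apply: sweep => //; [exact: measurable_residue|exact: res0].
exists A', (Num.min (r / 3) (e / 2)); split=> //; split=> //.
- by rewrite A'n.
- by rewrite lt_min; lra.
- by rewrite ge_min lexx orbT.
- by rewrite A'n.
- move=> i i_n; rewrite A'n; apply: mixes_weaken (rA' i i_n).
  have : Num.min (r / 3) (e / 2) <= r / 3 by rewrite ge_min lexx.
  lra.
Qed.

(** Dependent choice on stages, prefixes and budgets.  Each stage keeps the
    prefix of the previous one, so the diagonal of the chosen sequences is the
    tower. *)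
Lemma tower_exists (D : set (set X)) :
  D `<=` measurable ->
  (forall a B, D a -> measurable B -> 0 < m a -> 0 < m B ->
    exists2 e : R, 0 < e & mixes e a B) ->
  (forall r : R, 0 < r -> exists2 a, D a & 0 < m a <= r) ->
  exists (A : nat -> set X) (e : nat -> R),
    [/\ e 0%N = 1, 0 < e 0%N & forall n, tower_step D n A (e n) (e n.+1)].
Proof.
move=> mD sweep small.
pose good (s : nat * (nat -> set X) * R) := let: (n, A, e) := s in
  [/\ 0 < e, forall k, measurable (A k) &
      forall i, (i < n)%N -> e < m (residue A i n)].
pose next (s t : {s | good s}) := let: (n, A, e) := sval s in
  let: (n', A', e') := sval t in
  [/\ n' = n.+1, forall k, (k < n)%N -> A' k = A k & tower_step D n A' e e'].
have good0 : good (0%N, fun=> set0, 1) by split=> // k; exact: measurable0.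
have next_ex s : {t | next s t}.
  apply: cid; case: s => -[[n A] e] [e0 mA eA].
  have [A' [e' [mA' A'A]]] := tower_extend mD sweep small e0 mA eA.
  move=> A'step; have [DA' e'0 e'e A'e res] := A'step.
  have g : good (n.+1, A', e').
    split=> // i; rewrite ltnS => /res /mixes_le-/(_ (mA' n)).
    by move=> /(_ (measurable_residue i n.+1 mA')); lra.
  by exists (exist good _ g).
have [f [f0 fS]] := dependent_choice next_ex (exist good _ good0).
pose A_ n := (sval (f n)).1.2; pose e_ n := (sval (f n)).2.
have fn n : (sval (f n)).1.1 = n.
  elim: n => [|n ih]; first by rewrite f0.
  move: (fS n) ih; rewrite /next.
  by case: (sval (f n)) (sval (f n.+1)) => [[? ?] ?] [[? ?] ?] /= [-> _ _] ->.
have fSn n : (forall k, (k < n)%N -> A_ n.+1 k = A_ n k) /\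
             tower_step D n (A_ n.+1) (e_ n) (e_ n.+1).
  move: (fS n) (fn n); rewrite /next /A_ /e_.
  by case: (sval (f n)) (sval (f n.+1)) => [[? ?] ?] [[? ?] ?] /= [_ ? ?] <-.
exists (fun k => A_ k.+1 k), e_; split; [by rewrite /e_ f0|by rewrite /e_ f0|].
have stab n k : (k < n)%N -> A_ n k = A_ k.+1 k.
  elim: n => // n ih; rewrite ltnS leq_eqVlt => /orP[/eqP->//|kn].
  by rewrite (fSn n).1// ih.
move=> n; have [_ [DA e0 ee Ae res]] := fSn n; split=> // i i_n.
by rewrite -(@eq_residue (A_ n.+1))//; [exact: res|exact: stab].
Qed.

(** * Disjoint cores *)

Lemma budget_vanishes (e : nat -> R) : e 0%N = 1 -> (forall n, e n.+1 <= e n / 2) ->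
  forall r, 0 < r -> exists N, forall n, (N <= n)%N -> e n < r.
Proof.
move=> e0 ee r r0; have e_le n : e n <= n.+1%:R^-1.
  elim: n => [|n ih]; first by rewrite e0 invr1.
  apply: (le_trans (ee n)); apply: (@le_trans _ _ (n.+1%:R^-1 / 2)).
    by rewrite ler_pM2r ?invr_gt0.
  rewrite -invfM lef_pV2 ?posrE ?mulr_gt0 ?ltr0n// -natrM ler_nat muln2 -addnn.
  by rewrite addSn ltnS leq_addl.
have [N _ Nr] := near_infty_natSinv_lt (PosNum r0).
by exists N => n /Nr/=; exact: le_lt_trans.
Qed.

Definition core (A : nat -> set X) (n : nat) : set X := A n `\` tail_union A n.+1.

Lemma measurable_core A n : (forall k, measurable (A k)) -> measurable (core A n).
Proof. by move=> mA; apply: measurableD => //; exact: measurable_tail_union. Qed.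

Lemma core_inj A i j x : core A i x -> core A j x -> i = j.
Proof.
wlog ij : i j / (i < j)%N.
  move=> wl ix jx; have [ij|ij|//] := ltngtP i j; first exact: wl.
  by apply/esym; exact: wl.
by move=> [_ nix] [jx _]; exfalso; apply: nix; exists j.
Qed.

(** What a residue at stage [n] still has to lose lies in the sets of index at
    least [n]. *)
Lemma residue_core A i n : (i < n)%N -> residue A i n `\` core A i `<=` tail_union A n.
Proof.
move=> i_n x [[Aix nx] ncore]; apply: contrapT => ntail; apply: ncore; split=> //.
move=> [k /= ik Akx]; have [kn|nk] := ltnP k n.
  by apply: nx; exists k => //=; rewrite ik.
by apply: ntail; exists k.
Qed.

(** * The algebra of recoded sets *)

Section recoding.
Context (A B : nat -> set X).

(** Cores of index below [p] are left alone, so that the change stays within the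
    tail at [p]. *)
Definition recode (p : nat) : set X :=
  (B p `\` \bigcup_(j in [set j | (p <= j)%N]) core A j) `|`
  \bigcup_(j in [set j | (p <= j)%N && code_bit j p]) core A j.

Context (mA : forall k, measurable (A k)).
Context (mB : forall k, measurable (B k)).

Lemma measurable_recode p : measurable (recode p).
Proof.
by apply: measurableU; [apply: measurableD => //|]; apply: bigcup_measurable => j _;
  exact: measurable_core.
Qed.

Lemma recode_core p j x : (p <= j)%N -> core A j x -> recode p x <-> code_bit j p.
Proof.
move=> pj jx; split=> [[[_ []]|[i /= /andP[_ ip] ix]]|jp].
- by exists j.
- by rewrite (core_inj jx ix).
- by right; exists j => //=; rewrite pj.
Qed.

Lemma recode_near p : recode p `+` B p `<=` tail_union A p.
Proof.
have coretail j x : (p <= j)%N -> core A j x -> tail_union A p x.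
  by move=> pj [Ajx _]; exists j.
move=> x [[[[Bx _]//|[j /= /andP[pj _] jx]] _]|[Bx nx]]; first exact: coretail jx.
apply: contrapT => ntail; apply: nx; left; split=> // -[j /= pj jx].
by apply: ntail; exact: coretail jx.
Qed.

(** A set determined by finitely many of the recoded sets is a finite union of
    their atoms, so this is the algebra that they generate; closure under the
    operations and the search for cores need no normal form in this guise. *)
Definition recoded_algebra : set (set X) := [set E | measurable E /\
  exists n, forall x y, (forall p, (p < n)%N -> recode p x <-> recode p y) -> E x -> E y].

Lemma recoded_algebraP : set_algebra recoded_algebra.
Proof.
split; first by split; [exact: measurableT|exists 0%N].
- move=> E [ME [n nE]]; split; first exact: measurableC.
  by exists n => x y xy nEx Ey; apply: nEx; apply: nE Ey => p pn; split=> /xy; exact.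
- move=> E F [ME [n nE]] [mF [n' nF]]; split; first exact: measurableU.
  exists (maxn n n') => x y xy [Ex|Fx]; [left|right].
    by apply: nE Ex => p pn; apply: xy; rewrite leq_max pn.
  by apply: nF Fx => p pn; apply: xy; rewrite leq_max pn orbT.
Qed.

Lemma recode_in_algebra p : recoded_algebra (recode p).
Proof.
split; first exact: measurable_recode.
by exists p.+1 => x y /(_ p (leqnn _))[].
Qed.

(** Copy onto a core, by the choice of its index, the membership pattern of
    some point of [E] with respect to the recoded sets that determine [E]. *)
Lemma recoded_algebra_core E N : recoded_algebra E -> E !=set0 ->
  exists2 j, (N <= j)%N & core A j `<=` E.
Proof.
move=> [_ [n nE]] [x Ex].
have [j Nj jb] := code_bit_pattern (fun p => `[< recode p x >]) n (maxn N n).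
exists j; first by rewrite (leq_trans _ Nj)// leq_maxl.
move=> y jy; apply: nE Ex => p pn.
have pj : (p <= j)%N by rewrite ltnW// (leq_trans pn)// (leq_trans _ Nj)// leq_maxr.
by rewrite (recode_core pj jy) jb//; split=> /asboolP.
Qed.

End recoding.

Lemma pos_measure_nonempty E : (0 < mu E)%E -> E !=set0.
Proof. by move=> E0; apply/set0P; apply: contraTneq E0 => ->; rewrite measure0 ltxx. Qed.

(** Both the source [A n], which is its own residue at stage [n.+1], and the
    target lose at most [e n.+1] when they are shrunk to their cores. *)
Lemma core_mixes A e i n : (forall k, measurable (A k)) ->
  (forall k, m (tail_union A k) <= e k) -> (i <= n)%N ->
  mixes (3 * e n.+1) (A n) (residue A i n.+1) -> mixes (e n.+1) (core A n) (core A i).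
Proof.
move=> mA tl i_n; have mC k := measurable_core k mA.
have mR k := measurable_residue k n.+1 mA.
have mtl := measurable_tail_union n.+1 mA.
have bd k : (k <= n)%N -> m (residue A k n.+1 `\` core A k) <= e n.+1.
  move=> kn; apply: le_trans (tl n.+1); apply: fine_prob_le => //; first exact: measurableD.
  exact: residue_core.
rewrite -{1}(residue_last A n) => mix; have -> : e n.+1 = 3 * e n.+1 - e n.+1 - e n.+1 by lra.
by apply: mixes_perturb mix => //; exact: bd.
Qed.

(** * The two cases *)

(** The repetition allows a set to be approximated by a term [B p] of large
    index, that is, one that recoding hardly changes. *)
Lemma dense_enum (C : set (set X)) : countable C -> dense_collection mu C ->
  exists B : nat -> set X, (forall p, measurable (B p)) /\
    forall Q, measurable Q -> forall r, 0 < r -> forall N,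
      exists2 p, (N <= p)%N & (mu (B p `+` Q) < r%:E)%E.
Proof.
move=> /countable_injP[f f_inj] [mC C_dense].
pose B p := xget set0 [set c | C c /\ f c = repeat_index p].
exists B; split=> [p|Q mQ r r0 N].
  by rewrite /B; case: xgetP => [c _ [/mC]|_].
have [c Cc cQ] := C_dense Q mQ r r0.
have [p Np pc] := repeat_index_cofinal (f c) N.
exists p => //; suff -> : B p = c by [].
rewrite /B; case: xgetP => [c' _ [Cc' fc']|/(_ c)[]]; last by rewrite pc.
by apply: f_inj; rewrite ?inE// fc' pc.
Qed.

Lemma measurable_symdiff (P Q : set X) : measurable P -> measurable Q ->
  measurable (P `+` Q).
Proof. by move=> mP mQ; apply: measurableU; exact: measurableD. Qed.

Lemma symdiff_triangle (P Q S : set X) : measurable P -> measurable Q -> measurable S ->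
  m (P `+` S) <= m (P `+` Q) + m (Q `+` S).
Proof.
move=> mP mQ mS.
have mPQ := measurable_symdiff mP mQ; have mQS := measurable_symdiff mQ mS.
apply: le_trans (fine_probU_le mPQ mQS).
apply: fine_prob_le; [exact: measurable_symdiff|exact: measurableU|].
move=> x [[Px nSx]|[Sx nPx]]; have [Qx|nQx] := pselect (Q x).
- by right; left.
- by left; left.
- by left; right.
- by right; right.
Qed.

Lemma small_sets_case (D : set (set X)) :
  separable_probability mu -> D `<=` measurable ->
  (forall a B, D a -> measurable B -> 0 < m a -> 0 < m B ->
    exists2 e : R, 0 < e & mixes e a B) ->
  (forall r : R, 0 < r -> exists2 a, D a & 0 < m a <= r) ->
  lightly_mixing_on_dense_algebra mu T.
Proof.
move=> [C C_count C_dense] mD sweep small.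
have [B [mB B_dense]] := dense_enum C_count C_dense.
have [A [e [e0 e_pos eA]]] := tower_exists mD sweep small.
have mA k : measurable (A k) by have [/mD] := eA k.
have e_gt0 n : 0 < e n by case: n => [//|n]; have [] := eA n.
have tl : forall n, m (tail_union A n) <= e n.
  by apply: fine_prob_tail_le => // n; have [] := eA n.
exists (recoded_algebra A B); split.
- exact: recoded_algebraP.
- split=> [E []//|Q mQ r r0].
  have [N Ne] : exists N, forall n, (N <= n)%N -> e n < r / 2.
    by apply: budget_vanishes; rewrite ?divr_gt0// => n; have [] := eA n.
  have r2 : 0 < r / 2 by rewrite divr_gt0.
  have [p Np pQ] := B_dense Q mQ _ r2 N.
  have mBp := measurable_recode mA mB p.
  exists (recode A B p); first exact: recode_in_algebra.
  rewrite /symdiff_dist fine_probE ?lte_fin; last exact: measurable_symdiff.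
  have := symdiff_triangle mBp (mB p) mQ.
  have : m (recode A B p `+` B p) <= m (tail_union A p).
    by apply: fine_prob_le (@recode_near A B p);
      [exact: measurable_symdiff|exact: measurable_tail_union].
  move: pQ; rewrite fine_probE ?lte_fin; last exact: measurable_symdiff.
  by have := Ne p Np; have := tl p; lra.
- move=> E F GE GF /pos_measure_nonempty E0 /pos_measure_nonempty F0.
  (* The core in the target is fixed first: its index must be the smaller one. *)
  have [i _ iF] := recoded_algebra_core 0 GF F0.
  have [j ij jE] := recoded_algebra_core i GE E0.
  have [mEE _] := GE; have [mF _] := GF.
  apply/mixesP => //; exists (e j.+1) => //.
  apply: (mixes_subset _ _ _ _ jE iF) => //; try exact: measurable_core.
  by apply: core_mixes => //; have [_ _ _ _] := eA j; exact.
Qed.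

(** Approximation within [r] is then equality up to a null set, so every
    non-null set inherits sweeping out from a member of [D]. *)
Lemma no_small_sets_case (D : set (set X)) (r : R) :
  dense_collection mu D ->
  (forall a B, D a -> measurable B -> 0 < m a -> 0 < m B ->
    exists2 e : R, 0 < e & mixes e a B) ->
  0 < r -> (forall a, measurable a -> m a < r -> m a = 0) ->
  lightly_mixing_on_dense_algebra mu T.
Proof.
move=> [mD D_dense] sweep r0 gap.
exists measurable; split.
- by split; [exact: measurableT|exact: measurableC|exact: measurableU].
- by split=> // Q mQ e e0; exists Q => //; rewrite /symdiff_dist setYK measure0 lte_fin.
- move=> P Q mP mQ P0 Q0.
  have [a Da] := D_dense P mP r r0; have ma := mD a Da.
  have maP := measurable_symdiff ma mP.
  rewrite /symdiff_dist fine_probE// lte_fin => /(gap _ maP) aP0.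
  have m0 S : measurable S -> S `<=` a `+` P -> m S <= 0.
    by move=> mS SaP; rewrite -aP0; exact: fine_prob_le.
  have aP : m (a `\` P) <= 0 by apply: m0; [exact: measurableD|move=> x; left].
  have Pa : m (P `\` a) <= 0 by apply: m0; [exact: measurableD|move=> x; right].
  move: P0 Q0; rewrite (fine_probE mP) (fine_probE mQ) !lte_fin => P0 Q0.
  have a0 : 0 < m a.
    apply: lt_le_trans P0 _; have := fine_probD_ge mP ma; move: Pa; lra.
  have [e e0 eaQ] := sweep a Q Da mQ a0 Q0.
  apply/mixesP => //; exists e => //; have -> : e = e - 0 - 0 by rewrite !subr0.
  by apply: mixes_perturb eaQ => //; rewrite setDv measure0.
Qed.

End probability_reals.

Theorem corollary4p3 (d : measure_display) (X : measurableType d)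
    (R : realType) (mu : probability X R) (T : X -> X)
    (sep_mu : separable_probability mu)
    (T_transformation : transformation T)
    (T_preserving : measure_preserving mu T)
    (T_sweeping : sweeping_out_on_dense_collection mu T) :
  lightly_mixing_on_dense_algebra mu T.
Proof.
have [D [D_dense D_sweep]] := T_sweeping; have [mD dD] := D_dense.
have sweep a B : D a -> measurable B -> 0 < fine (mu a) -> 0 < fine (mu B) ->
    exists2 e : R, 0 < e & mixes mu T e a B.
  move=> Da mB a0 B0; have ma := mD a Da; apply/mixesP => //.
  by apply: D_sweep => //; rewrite fine_probE ?lte_fin.
have [[r [r0 gap]]|nogap] := pselect (exists r, 0 < r /\
    forall a, measurable a -> fine (mu a) < r -> fine (mu a) = 0).
  exact: (no_small_sets_case T_transformation T_preserving D_dense sweep r0 gap).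
apply: (small_sets_case T_transformation T_preserving sep_mu mD sweep) => r r0.
apply: contrapT => none.
apply: nogap; exists (r / 2); split=> [|a ma ar]; first by rewrite divr_gt0.
apply: contrapT => /eqP a_neq0.
have a0 : 0 < fine (mu a) by rewrite lt_neqAle eq_sym a_neq0 fine_prob_ge0.
(* A member of [D] within [mu a] of [a] is not null and has measure below
   [2 * mu a], hence below [r]. *)
have [b Db] := dD a ma (fine (mu a)) a0; have mb := mD b Db.
have mba := measurable_symdiff mb ma.
rewrite /symdiff_dist fine_probE// lte_fin => ba; apply: none; exists b => //.
have ba1 : fine (mu (b `\` a)) <= fine (mu (b `+` a)).
  by apply: fine_prob_le => //; [exact: measurableD|move=> x; left].
have ab1 : fine (mu (a `\` b)) <= fine (mu (b `+` a)).
  by apply: fine_prob_le => //; [exact: measurableD|move=> x; right].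
have b_a := fine_probD_ge mu mb ma; have a_b := fine_probD_ge mu ma mb.
apply/andP.
by split; lra.
Qed.
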